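(* Let $T\in{\tt INC}(\nu/\lambda)$ be a shifted increasing tableau, and let $\mu$ be a shape. If $T$ rectifies to the superstandard tableau $S_\mu$ using one $K$-rectification order, then $T$ rectifies to $S_\mu$ using any $K$-rectification order.
   Context: Fix $n\ge 1$. Boxes are written $(i,j)$ with row $i$ (numbered from the top) and column $j$ (numbered from the left). Let $\Lambda=\{(i,j):1\le i\le j\le n\}$ (the shifted staircase of $(n,n-1,\dots,1)$). A shape is a partition $\lambda=(\lambda_1>\lambda_2>\dots>\lambda_\ell>0)$ with distinct parts and $\lambda_1\le n$, identified with its shifted Young diagram $\{(i,j): 1\le i\le \ell,\ i\le j\le i+\lambda_i-1\}\subseteq\Lambda$. For shapes $\lambda\subseteq\nu$, the shifted skew shape $\nu/\lambda$ is the set of boxes of $\nu$ not in $\lambda$; it is straight if $\lambda=\emptyset$. A shifted increasing tableau of shape $\nu/\lambda$ is a filling of the boxes of $\nu/\lambda$ by nonnegative integers, strictly increasing along each row (left to right) and each column (top to bottom); ${\tt INC}(\nu/\lambda)$ is the set of these. The superstandard tableau $S_\mu$ of straight shape $\mu$ has first row $1,2,\dots,\mu_1$, second row $\mu_1+1,\dots,\mu_1+\mu_2$, etc. Jeu de taquin. For $T\in{\tt INC}(\nu/\lambda)$, an inner corner is a maximally southeast box of $\lambda$ (a box of $\lambda$ whose neighbours to the right and below are not in $\lambda$). A short ribbon is an edge-connected shifted skew shape with at most two boxes in any row or column and no $2\times2$ subshape. An alternating ribbon is a short ribbon filled with two symbols so that adjacent boxes are filled differently. The operation ${\tt switch}$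 interchanges the two symbols of an alternating ribbon, except that it does nothing if the ribbon is a single box; on a union of alternating ribbons (the edge-connected components) it acts on each separately. Given a nonempty set ${\bf x}$ of inner corners, fill each with $\bullet$. Then, for each label $1,2,3,\dots$ of $T$ successively in increasing order, apply ${\tt switch}$ to the union of alternating ribbons consisting of all boxes currently containing $\bullet$ or that label. When the $\bullet$'s have been switched past all entries of $T$, delete them; the resulting placement of numbers is the increasing tableau $K{\tt jdt}_{\bf x}(T)$, whose inner shape is $\lambda\setminus{\bf x}$. A sequence of successive $K{\tt jdt}$ operations leading from $T$ to a straight shape tableau $U$ is a $K$-rectification; one says $T$ rectifies to $U$, and the sequence of choices is called a $K$-rectification order. Such an order is encoded by an increasing tableau $R\in{\tt INC}(\lambda)$: the boxes of $R$ with the largest label are the inner corners used in the first slide, those with the second largest label the inner corners used in the second slide, etc. *)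

(* Defs.v *)
From mathcomp Require Import all_boot.

Set Implicit Arguments.
Unset Strict Implicit.
Unset Printing Implicit Defensive.

(* The box in row i and column j of the n x n grid, counted from 0 (the box   *)
(* (i, j) of the usual convention is thus (i.-1, j.-1) here).  The shifted    *)
(* staircase consists of the boxes with i <= j, and contains every diagram.   *)
Definition box (n : nat) : finType := ('I_n * 'I_n)%type.

Definition is_shape (n : nat) (la : seq nat) : bool :=
  [&& sorted gtn la, all (leq 1) la & head 0 la <= n].

Definition diagram (n : nat) (la : seq nat) : {set box n} :=
  [set c : box n | (c.1 < size la) && (c.1 <= c.2 < c.1 + nth 0 la c.1)].

Definition skew (n : nat) (nu la : seq nat) : {set box n} :=
  diagram n nu :\: diagram n la.

(* None marks the boxes that are not filled. *)
Definition filling (n : nat) (S : Type) := {ffun box n -> option S}.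

Definition tableau (n : nat) := filling n nat.

Definition increasing (n : nat) (T : tableau n) : Prop :=
  (forall (i j j' : 'I_n) (a b : nat),
     j < j' -> T (i, j) = Some a -> T (i, j') = Some b -> a < b) /\
  (forall (i i' j : 'I_n) (a b : nat),
     i < i' -> T (i, j) = Some a -> T (i', j) = Some b -> a < b).

Definition INC (n : nat) (nu la : seq nat) (T : tableau n) : Prop :=
  (forall c : box n, isSome (T c) = (c \in skew n nu la)) /\ increasing T.

Definition superstandard (n : nat) (mu : seq nat) : tableau n :=
  [ffun c : box n =>
     if c \in diagram n mu
     then Some (sumn (take c.1 mu) + (c.2 - c.1).+1)
     else None].

Definition is_right (n : nat) (c d : box n) : bool :=
  (d.1 == c.1) && (nat_of_ord d.2 == c.2.+1).

Definition is_below (n : nat) (c d : box n) : bool :=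
  (d.2 == c.2) && (nat_of_ord d.1 == c.1.+1).

Definition adjacent (n : nat) (c d : box n) : bool :=
  [|| is_right c d, is_right d c, is_below c d | is_below d c].

Definition inner_corners (n : nat) (D : {set box n}) : {set box n} :=
  [set c in D | [forall d in D, ~~ is_right c d && ~~ is_below c d]].

Definition component (n : nat) (A : {set box n}) (c : box n) : {set box n} :=
  [set d | connect (fun x y => [&& x \in A, y \in A & adjacent x y]) c d].

Definition symbol : eqType := (unit + nat)%type.
Definition bullet : symbol := inl tt.
Definition label (k : nat) : symbol := inr k.

Definition swap (s t u : symbol) : symbol :=
  if u == s then t else if u == t then s else u.

(* Acts on the union of the boxes filled with s or t.  The operation is meant *)
(* for the case where every edge-connected component of that union is an      *)
(* alternating ribbon, which holds at each step of a K-jdt slide of an        *)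
(* increasing tableau; its value on other fillings is irrelevant.             *)
Definition switch (n : nat) (s t : symbol) (F : filling n symbol) :
    filling n symbol :=
  let A := [set c | (F c == Some s) || (F c == Some t)] in
  [ffun c => if (c \in A) && (1 < #|component A c|)
             then omap (swap s t) (F c) else F c].

Definition labels (n : nat) (T : tableau n) : seq nat :=
  sort leq (undup (pmap T (enum {: box n}))).

Definition add_bullets (n : nat) (x : {set box n}) (T : tableau n) :
    filling n symbol :=
  [ffun c => if c \in x then Some bullet else omap label (T c)].

Definition delete_bullets (n : nat) (F : filling n symbol) : tableau n :=
  [ffun c => if F c is Some (inr k) then Some k else None].

Definition Kjdt (n : nat) (x : {set box n}) (T : tableau n) : tableau n :=
  delete_bullets
    (foldl (fun F k => switch bullet (label k) F) (add_bullets x T) (labels T)).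

(* D is the diagram of the current inner shape; the slide along x turns it    *)
(* into D :\: x, and the last slide must exhaust it.                          *)
Fixpoint Krect_order (n : nat) (D : {set box n}) (xs : seq {set box n}) : bool :=
  if xs is x :: xs' then
    [&& x != set0, x \subset inner_corners D & Krect_order (D :\: x) xs']
  else D == set0.

Definition Krect (n : nat) (xs : seq {set box n}) (T : tableau n) : tableau n :=
  foldl (fun U x => Kjdt x U) T xs.

Definition rectifies_using (n : nat) (la : seq nat) (xs : seq {set box n})
    (T U : tableau n) : Prop :=
  Krect_order (diagram n la) xs /\ Krect xs T = U.

(* Main.v *)
From Stdlib Require Import ZArith Lia.
Require Import Defs.
From mathcomp Require Import all_boot zify.

Set Implicit Arguments.
Unset Strict Implicit.
Unset Printing Implicit Defensive.

(** Two statistics of an increasing tableau survive every slide, and together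
    they pin down a superstandard tableau among the straight ones.

    Both statistics look only at the entries in a fixed interval [[a, b]].  The
    first is the set of lengths of _chains_: increasing sequences of entries
    that first go strictly down in rows and then strictly right in columns.  In
    terms of the row reading word w these are the increasing subsequences of
    the reverse of w followed by w.  The second is whether there is a _spread_:
    an entry x with a smaller entry y and a larger entry z such that both y and
    z come before x in w.  Chain lengths alone would not do: the tableau with
    rows 1 2 3 and 3 and the one-row tableau 1 2 3 have the same chain lengths
    in every interval, but only the former has a spread.

    A slide is a sequence of switches of the bullets with a label k.  A switch
    moves only the entries k, each to the bullets immediately to its left or
    above it, so a chain or a spread through k is repaired by local surgery: if
    the moved k no longer fits next to its neighbour in the chain, then the
    corner of the rectangle that they span holds an entry that replaces k
    ([descent_advance], [ascent_after], [spread_advance]).  The only case in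
    which that corner is missing is a k on the diagonal; then the first phase
    of the chain is cut at k and its remainder is rerouted along the row of k
    ([ascent_past_diagonal]).  This shows that chains and spreads survive a
    switch.  The converse needs no new argument: reflection in the antidiagonal
    together with negation of the entries maps the staircase to itself, runs
    switches backwards, and exchanges the two phases of a chain and the two
    forms of a spread ([switch_recedes], [chain_switch], [spread_switch]).

    On a straight tableau whose rows from r on hold exactly the entries above
    m, the chains with entries in [[m + 1, b]] have length at most the number of
    entries of row r that are at most b, with equality attained
    ([chain_first_row]).  So chain lengths determine the rows one after the
    other, provided that the entries of the later rows are known to lie above
    those of row r.  For a superstandard tableau row r fills an interval, and a
    single row has no spread; the absence of a spread in that interval forces
    the diagonal entry of row r + 1 above it in every straight tableau with the
    same statistics ([rigid]). *)

(** * Placements and their statistics *)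

Section Placements.
Local Open Scope Z_scope.

(** A filling of boxes of the plane by integers: [G i j u] says that the box in
    row [i] and column [j] holds [u].  Working over all of Z makes the
    antidiagonal reflection and the negation of entries total operations. *)
Definition placement := Z -> Z -> Z -> Prop.

Record shifted_increasing (G : placement) : Prop := ShiftedIncreasing {
  on_staircase : forall i j u, G i j u -> i <= j;
  convex : forall i j u i' j' u' r s, G i j u -> G i' j' u' ->
    i <= r <= i' -> j <= s <= j' -> r <= s -> exists w, G r s w;
  increases : forall i j u i' j' u', G i j u -> G i' j' u' ->
    i <= i' -> j <= j' -> u < u' \/ i = i' /\ j = j' /\ u = u' }.

(** The part of the effect of a switch on the entries equal to [k] that is
    enough to carry statistics from [G] to [G'].  The bullets are the entries
    [k - 1] of [G]; in [G'] they are the entries [k + 1]. *)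
Record advances (k : Z) (G G' : placement) : Prop := Advances {
  adv_increasing : shifted_increasing G;
  adv_keep : forall i j u, G i j u -> u <> k - 1 -> u <> k -> G' i j u;
  adv_left : forall i j, G i j k -> G i (j - 1) (k - 1) -> G' i (j - 1) k;
  adv_up : forall i j, G i j k -> G (i - 1) j (k - 1) -> G' (i - 1) j k;
  adv_cases : forall i j, G i j k ->
    [\/ G i (j - 1) (k - 1), G (i - 1) j (k - 1) | G' i j k] }.

(** Reflection in the antidiagonal, with the order of the entries reversed. *)
Definition dual (G : placement) : placement :=
  fun i j u => G (- j) (- i) (- u).

(** The entries in [[a, b]] other than the bullets, which are equal to [e]. *)
Definition numbers (e a b : Z) (G : placement) : placement :=
  fun i j u => [/\ G i j u, u <> e & a <= u <= b].

(** The first phase of a chain, listed from its end: [p] entries below [t] in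
    rows above row [i]. *)
Fixpoint descent (H : placement) (p : nat) (i t : Z) : Prop :=
  if p is p'.+1 then
    exists r c u, [/\ H r c u, r < i, u < t & descent H p' r u]
  else True.

(** The second phase of a chain, listed from its start: [q] entries above [s]
    in columns to the right of column [j]. *)
Fixpoint ascent (H : placement) (q : nat) (j s : Z) : Prop :=
  if q is q'.+1 then
    exists r c u, [/\ H r c u, j < c, s < u & ascent H q' c u]
  else True.

(** No condition links the position of the last entry of the first phase to
    that of the first entry of the second; [t <= s + 1] only says that the
    former is smaller. *)
Definition chain (H : placement) (l : nat) : Prop :=
  exists p q i j t s,
    [/\ l = (p + q)%N, descent H p i t, ascent H q j s & t <= s + 1].

(** The entry y at [(iy, jy)] and the entry z at [(iz, jz)] precede x at
    [(i, j)] in the row reading word or in the column reading word.  In a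
    tableau the two alternatives are equivalent, since the missing corner of
    the relevant rectangle is filled; in the middle of a slide that corner may
    be a bullet, and a switch can turn one alternative into the other. *)
Definition spread (H : placement) : Prop :=
  exists i j u iy jy uy iz jz uz,
    [/\ H i j u, H iy jy uy, H iz jz uz, uy < u < uz &
       (i <= iy /\ i < iz) \/ (jz <= j /\ jy < j)].

Lemma descent_dual H p i t :
  descent H p i t -> ascent (dual H) p (- i) (- t).
Proof.
elim: p i t => //= p IH i t [r [c [u [Hu ri ut /IH D]]]].
exists (- c), (- r), (- u); rewrite /dual !Z.opp_involutive.
by split=> //; lia.
Qed.

Lemma ascent_dual H q j s :
  ascent H q j s -> descent (dual H) q (- j) (- s).
Proof.
elim: q j s => //= q IH j s [r [c [u [Hu jc su /IH D]]]].
exists (- c), (- r), (- u); rewrite /dual !Z.opp_involutive.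
by split=> //; lia.
Qed.

Lemma chain_dual H l : chain H l -> chain (dual H) l.
Proof.
case=> p [q [i [j [t [s [-> /descent_dual D /ascent_dual A ts]]]]]].
exists q, p, (- j), (- i), (- s), (- t); split=> //; last by lia.
by rewrite addnC.
Qed.

Lemma spread_dual H : spread H -> spread (dual H).
Proof.
case=> i [j [u [iy [jy [uy [iz [jz [uz [Hx Hy Hz uu C]]]]]]]]].
exists (- j), (- i), (- u), (- jz), (- iz), (- uz), (- jy), (- iy), (- uy).
by rewrite /dual !Z.opp_involutive; split=> //; lia.
Qed.

Lemma descent_sub (H H' : placement) p i t i' t' :
  (forall r c u, H r c u -> u < t -> H' r c u) -> i <= i' -> t <= t' ->
  descent H p i t -> descent H' p i' t'.
Proof.
elim: p i t i' t' => //= p IH i t i' t' sub ii tt [r [c [u [Hu ri ut D]]]].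
exists r, c, u; split; [exact: sub | lia | lia |].
apply: (IH r u r u) D; [|lia|lia].
by move=> r' c' u' ? ?; apply: sub => //; lia.
Qed.

Lemma ascent_sub (H H' : placement) q j s j' s' :
  (forall r c u, H r c u -> s < u -> H' r c u) -> j' <= j -> s' <= s ->
  ascent H q j s -> ascent H' q j' s'.
Proof.
elim: q j s j' s' => //= q IH j s j' s' sub jj ss [r [c [u [Hu ri ut D]]]].
exists r, c, u; split; [exact: sub | lia | lia |].
apply: (IH c u c u) D; [|lia|lia].
by move=> r' c' u' ? ?; apply: sub => //; lia.
Qed.

Lemma chain_sub (H H' : placement) l :
  (forall r c u, H r c u -> H' r c u) -> chain H l -> chain H' l.
Proof.
move=> sub [p [q [i [j [t [s [-> D A ts]]]]]]].
exists p, q, i, j, t, s; split=> //.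
  by apply: descent_sub D => *; [exact: sub | lia..].
by apply: ascent_sub A => *; [exact: sub | lia..].
Qed.

Lemma spread_sub (H H' : placement) :
  (forall r c u, H r c u -> H' r c u) -> spread H -> spread H'.
Proof.
move=> sub [i [j [u [iy [jy [uy [iz [jz [uz [Hx Hy Hz uu C]]]]]]]]]].
by exists i, j, u, iy, jy, uy, iz, jz, uz; split; auto.
Qed.

Lemma dual_increasing G : shifted_increasing G -> shifted_increasing (dual G).
Proof.
case=> st co inc; rewrite /dual; split.
- by move=> i j u /st; lia.
- move=> i j u i' j' u' r s Gu Gu' ri sj rs.
  have [w] := co _ _ _ _ _ _ (- s) (- r) Gu' Gu ltac:(lia) ltac:(lia) ltac:(lia).
  by exists (- w); rewrite Z.opp_involutive.
- by move=> i j u i' j' u' Gu Gu' ii jj; have := inc _ _ _ _ _ _ Gu' Gu; lia.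
Qed.

(** * A switch preserves chains and spreads *)

Section Advance.
Variables (k a b : Z) (G G' : placement).
Hypothesis adv : advances k G G'.

Let incG := adv_increasing adv.
Let H := numbers (k - 1) a b G.
Let H' := numbers (k + 1) a b G'.

Hypothesis gap : forall i j, ~ G i j (k + 1).

Lemma keep i j u : H i j u -> u <> k -> H' i j u.
Proof.
case=> Gu ne ab nk; split=> //; first exact: adv_keep Gu ne nk.
by move=> E; apply: (@gap i j); rewrite -E.
Qed.

Lemma between i j u i' j' u' r s :
  G i j u -> G i' j' u' -> i <= r <= i' -> j <= s <= j' -> r <= s ->
  exists w, [/\ G r s w, u < w \/ i = r /\ j = s /\ u = w &
                w < u' \/ i' = r /\ j' = s /\ u' = w].
Proof.
move=> Gu Gu' ri sj rs; have [w Gw] := convex incG Gu Gu' ri sj rs.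
exists w; split=> //; first by apply: (increases incG Gu Gw); lia.
by have := increases incG Gw Gu' ltac:(lia) ltac:(lia); lia.
Qed.

Lemma descent_low p i t : t <= k -> descent H p i t -> descent H' p i t.
Proof.
move=> tk; apply: descent_sub; [|lia|lia] => r c u Hu ut.
by apply: keep => //; lia.
Qed.

Lemma ascent_high q j s : k <= s -> ascent H q j s -> ascent H' q j s.
Proof.
move=> tk; apply: ascent_sub; [|lia|lia] => r c u Hu ut.
by apply: keep => //; lia.
Qed.

(** When [k] moves up into the row of its predecessor in the chain, the box to
    the left of the old place of [k] lies in the rectangle spanned by the two;
    its entry is strictly between them and takes the place of [k], unless it is
    a bullet, to which [k] can then move instead.  That box is outside the
    staircase exactly when [k] sits on the diagonal, at [(e, e)].  The second
    alternative describes this case: [d] entries of the chain precede [k] and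
    [m] follow it in the first phase, the last one being [u] (or [k] itself if
    [m] is 0). *)
Lemma descent_advance p i t : descent H p i t ->
  descent H' p i t \/
  exists d m e r c u, [/\ p = (d.+1 + m)%N, descent H' d e k, H e e k,
    G' (e - 1) e k & [/\ H r c u, k <= u < t, r < i & e + Z.of_nat m <= r]].
Proof.
elim: p i t => [|p IH] i t /=; first by left.
case=> r [c [u [Hu ri ut D]]].
have [uk|uk] : u < k \/ k <= u by lia.
  left; exists r, c, u; split=> //; first by apply: keep => //; lia.
  by apply: descent_low D; lia.
have [nk|Ek] : k < u \/ u = k by lia.
  case: (IH _ _ D) => [D'|[d [m [e [r' [c' [u' [-> D' He G'e [Hr' uu rr er]]]]]]]]].
    by left; exists r, c, u; split=> //; apply: keep => //; lia.
  right; exists d, m.+1, e, r, c, u; split=> //; first by rewrite addnS.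
  by split=> //; lia.
subst u; have D' := descent_low (Z.le_refl k) D.
have [Gk kne ab] := Hu.
have use_left : G r (c - 1) (k - 1) -> descent H' p.+1 i t.
  move=> Gl; exists r, (c - 1), k; split=> //; split; [|lia|lia].
  exact: adv_left Gl.
case: (adv_cases adv Gk) => [Gl|Gup|G'k]; first by left; exact: use_left.
  have G'up := adv_up adv Gk Gup.
  have H'up : H' (r - 1) c k by split=> //; lia.
  case: p D D' use_left {IH} => [|p] D D' use_left.
    by left; exists (r - 1), c, k; split=> //; lia.
  case: D => r1 [c1 [u1 [Hu1 r1r u1k D1]]].
  have [Gu1 u1ne ab1] := Hu1.
  have [lt1|E1] : r1 < r - 1 \/ r1 = r - 1 by lia.
    left; exists (r - 1), c, k; split=> //; first lia.
    exists r1, c1, u1; split=> //; first by apply: keep => //; lia.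
    by apply: descent_low D1; lia.
  subst r1; have c1c : c1 < c.
    have [//|cc] : c1 < c \/ c <= c1 by lia.
    by have := increases incG Gup Gu1 ltac:(lia) cc; lia.
  have rc := on_staircase incG Gk; have r1c1 := on_staircase incG Gu1.
  have [ltrc|Erc] : r <= c - 1 \/ r = c by lia.
    have [w [Gw uw wk]] := between (r := r) (s := c - 1) Gu1 Gk ltac:(lia) ltac:(lia) ltrc.
    have [Ew|Nw] : w = k - 1 \/ w <> k - 1 by lia.
      by left; apply: use_left; rewrite -Ew.
    left; exists r, (c - 1), w; split; [|lia|lia|].
      by apply: keep; [split=> //; lia | lia].
    exists (r - 1), c1, u1; split; [|lia|lia|].
      by apply: keep => //; lia.
    by apply: descent_low D1; lia.
  subst c; right; exists p.+1, 0%N, r, r, r, k; split=> //.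
  - by rewrite addn0.
  - by split=> //; lia.
by left; exists r, c, k; split=> //; split=> //; lia.
Qed.

(** When [k] moves left into the column of its predecessor in the chain, the
    box above the old place of [k] plays the role that the box to its left
    plays in [descent_advance].  Going up or right never leaves the staircase,
    so there is no exceptional case. *)
Lemma ascent_after r c u q :
  H r c u -> u < k -> ascent H q c u -> ascent H' q c u.
Proof.
elim: q r c u => //= q IH r c u Hu uk [r1 [c1 [u1 [Hu1 cc1 uu1 A]]]].
have [u1k|k_u1] : u1 < k \/ k <= u1 by lia.
  exists r1, c1, u1; split=> //; first by apply: keep => //; lia.
  exact: (IH r1).
have A' := ascent_high k_u1 A.
have [nk|Ek] : k < u1 \/ u1 = k by lia.
  by exists r1, c1, u1; split=> //; apply: keep => //; lia.
subst u1; have [Gk kne ab] := Hu1; have [Gu une abu] := Hu.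
have use_up : G (r1 - 1) c1 (k - 1) -> ascent H' q.+1 c u.
  move=> Gup; exists (r1 - 1), c1, k; split=> //; split; [|lia|lia].
  exact: adv_up Gup.
case: (adv_cases adv Gk) => [Gl|Gup|G'k].
- have [lt|Ec] : c < c1 - 1 \/ c = c1 - 1 by lia.
    exists r1, (c1 - 1), k; split=> //.
      by split; [exact: adv_left Gl|lia|lia].
    by apply: ascent_sub A' => //; lia.
  have rr1 : r < r1.
    have [//|rr] : r < r1 \/ r1 <= r by lia.
    by have := increases incG Gl Gu rr ltac:(lia); lia.
  have rc := on_staircase incG Gk.
  have [w [Gw uw wk]] := between (r := r1 - 1) (s := c1) Gu Gk ltac:(lia) ltac:(lia) ltac:(lia).
  have [Ew|Nw] : w = k - 1 \/ w <> k - 1 by lia.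
    by apply: use_up; rewrite -Ew.
  exists (r1 - 1), c1, w; split; [|lia|lia|].
    by apply: keep; [split=> //; lia | lia].
  by apply: ascent_sub A' => //; lia.
- exact: use_up.
- by exists r1, c1, k; split=> //; split=> //; lia.
Qed.

(** An entry [k] that opens the second phase may move left freely, since the
    column of its predecessor is irrelevant. *)
Lemma ascent_advance q j s : ascent H q j s -> exists j', ascent H' q j' s.
Proof.
case: q => [|q] /=; first by exists 0.
case=> r [c [u [Hu jc su A]]].
have [uk|k_u] : u < k \/ k <= u by lia.
  exists j, r, c, u; split=> //; first by apply: keep => //; lia.
  exact: ascent_after Hu uk A.
have A' := ascent_high k_u A.
have [nk|Ek] : k < u \/ u = k by lia.
  by exists j, r, c, u; split=> //; apply: keep => //; lia.
subst u; have [Gk kne ab] := Hu.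
case: (adv_cases adv Gk) => [Gl|Gup|G'k].
- exists (j - 1), r, (c - 1), k; split=> //; [|lia|].
    by split; [exact: adv_left Gl|lia|lia].
  by apply: ascent_sub A' => //; lia.
- exists j, (r - 1), c, k; split=> //.
  by split; [exact: adv_up Gup|lia|lia].
- by exists j, r, c, k; split=> //; split=> //; lia.
Qed.

(** The [m] entries that follow a diagonal entry [k] in the first phase, the
    last of which is [u], reach a row at least [e + m].  Hence row [e] has at
    least [m] boxes to the right of the diagonal that are weakly northwest of
    [u], and their entries replace those [m] entries, now as part of the second
    phase.  The old second phase fits behind them: a box in a column up to
    [e + m] is in a row up to [e + m] too, hence northwest of [u], and holds an
    entry at most [u]. *)
Lemma ascent_past_diagonal e r c u m q j s : H e e k -> H r c u -> k <= u ->
  e + Z.of_nat m <= r -> u <= s -> ascent H q j s -> ascent H' (m + q) e k.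
Proof.
move=> [Ge _ abe] [Gu une abu] ku er us A.
have rc := on_staircase incG Gu.
have {}A : ascent H' q (e + Z.of_nat m) u.
  case: q A => //= q [r1 [c1 [u1 [Hu1 jc su A]]]].
  exists r1, c1, u1; split; [by apply: keep => //; lia| |lia|].
    have [//|cc] : e + Z.of_nat m < c1 \/ c1 <= e + Z.of_nat m by lia.
    have [Gu1 _ _] := Hu1; have := on_staircase incG Gu1 => r1c1.
    by have := increases incG Gu1 Gu ltac:(lia) ltac:(lia); lia.
  by apply: ascent_high A; lia.
suff IH : forall x y w, Z.of_nat x + Z.of_nat y = Z.of_nat m ->
    G e (e + Z.of_nat x) w -> ascent H' (y + q) (e + Z.of_nat x) w.
  by have := IH 0%N m k; rewrite Z.add_0_r; apply.
move=> x y; elim: y x => [|y IHy] x w xy Gw.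
  apply: ascent_sub A => //; first lia.
  by have := increases incG Gw Gu ltac:(lia) ltac:(lia); lia.
have [w' [Gw' ww' w'u]] :=
  between (r := e) (s := e + Z.of_nat x.+1) Gw Gu ltac:(lia) ltac:(lia) ltac:(lia).
have kw := increases incG Ge Gw ltac:(lia) ltac:(lia).
exists e, (e + Z.of_nat x.+1), w'; split; [|lia|lia|].
  by apply: keep; [split=> //; lia | lia].
by apply: IHy Gw'; lia.
Qed.

Lemma chain_advance l : chain H l -> chain H' l.
Proof.
case=> p [q [i [j [t [s [-> D A ts]]]]]].
have [sk|ks] : s < k \/ k <= s by lia.
  have [j' A'] := ascent_advance A.
  exists p, q, i, j', t, s; split=> //.
  by apply: descent_low D; lia.
case: (descent_advance D) => [D'|[d [m [e [r [c [u [-> D' He G'e [Hr ut ri er]]]]]]]]].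
  by exists p, q, i, j, t, s; split=> //; exact: ascent_high A.
exists d, (m + q).+1, e, (e - 1), k, (k - 1); split=> //; last lia.
  by rewrite addSn addnS addnA.
exists (e - 1), e, k; split; [|lia|lia|].
  by case: He => ? ? ?; split=> //; lia.
by apply: ascent_past_diagonal A => //; try exact: Hr => //; lia.
Qed.

(** The moved [k] may break the alternative that held before, by changing the
    row (for the first) or the column (for the second) of y, x or z; then
    either the other alternative holds after the move or one of the three
    entries can be exchanged for one in the spanned rectangle. *)
Lemma spread_advance : spread H -> spread H'.
Proof.
case=> i [j [u [iy [jy [uy [iz [jz [uz [Hx Hy Hz uu C]]]]]]]]].
have [Gx nx abx] := Hx; have [Gy ny aby] := Hy; have [Gz nz abz] := Hz.
have sx := on_staircase incG Gx.
have sy := on_staircase incG Gy.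
have sz := on_staircase incG Gz.
have [Ex|Nx] : u = k \/ u <> k by lia.
  subst u; have H'y : H' iy jy uy by apply: keep => //; lia.
  have H'z : H' iz jz uz by apply: keep => //; lia.
  case: (adv_cases adv Gx) => [Gl|Gup|G'k].
  - have H'l : H' i (j - 1) k by split; [exact: adv_left Gl|lia|lia].
    have iiz : i < iz.
      have [//|ii] : i < iz \/ iz <= i by lia.
      by have := increases incG Gz Gx ii; lia.
    have [iiy|iyi] : i <= iy \/ iy < i by lia.
      by exists i, (j - 1), k, iy, jy, uy, iz, jz, uz; split=> //; lia.
    have {}C : jz <= j /\ jy < j by lia.
    have [w [Gw uw wk]] := between (r := i - 1) (s := j) Gy Gx ltac:(lia) ltac:(lia) ltac:(lia).
    have [Ew|Nw] : w = k - 1 \/ w <> k - 1 by lia.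
      exists (i - 1), j, k, iy, jy, uy, iz, jz, uz; split=> //; last by right.
      by split; [apply: (adv_up adv Gx); rewrite -Ew|lia|lia].
    exists (i - 1), j, w, iy, jy, uy, iz, jz, uz; split=> //; [|lia|by right].
    by apply: keep; [split=> //; lia|lia].
  - exists (i - 1), j, k, iy, jy, uy, iz, jz, uz; split=> //; last lia.
    by split; [exact: adv_up Gup|lia|lia].
  - exists i, j, k, iy, jy, uy, iz, jz, uz; split=> //.
    by split=> //; lia.
have H'x : H' i j u by apply: keep => //; lia.
have [Ey|Ny] : uy = k \/ uy <> k by lia.
  subst uy; have H'z : H' iz jz uz by apply: keep => //; lia.
  case: (adv_cases adv Gy) => [Gl|Gup|G'k].
  - exists i, j, u, iy, (jy - 1), k, iz, jz, uz; split=> //; last lia.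
    by split; [exact: adv_left Gl|lia|lia].
  - have H'up : H' (iy - 1) jy k by split; [exact: adv_up Gup|lia|lia].
    have [Cup|[Ei [iiz jyj]]] : ((i <= iy - 1 /\ i < iz) \/ (jz <= j /\ jy < j))
        \/ i = iy /\ i < iz /\ jy < j.
      have [jj|//] : j <= jy \/ jy < j by lia.
        by have := increases incG Gx Gy; lia.
      lia.
    - by exists i, j, u, (iy - 1), jy, k, iz, jz, uz; split.
    subst iy.
    have [w [Gw uw wx]] := between (r := i - 1) (s := j) Gup Gx ltac:(lia) ltac:(lia) ltac:(lia).
    (* If the box above x holds k too, the second alternative takes over: y is
       left of x, and if z is right of x then the box below x replaces z; it is
       on the staircase because i <= jy < j. *)
    have [Ew|Nw] : w = k \/ w <> k by lia.
      have [Cz|jzj] : jz <= j \/ j < jz by lia.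
        by exists i, j, u, (i - 1), jy, k, iz, jz, uz; split=> //; lia.
      have [w' [Gw' uw' wx']] := between (r := i + 1) (s := j) Gx Gz ltac:(lia) ltac:(lia) ltac:(lia).
      exists i, j, u, (i - 1), jy, k, (i + 1), j, w'; split=> //; [|lia|lia].
      by apply: keep; [split=> //; lia|lia].
    exists (i - 1), j, w, (i - 1), jy, k, iz, jz, uz; split=> //; [|lia|lia].
    by apply: keep; [split=> //; lia|lia].
  - exists i, j, u, iy, jy, k, iz, jz, uz; split=> //.
    by split=> //; lia.
have H'y : H' iy jy uy by apply: keep => //; lia.
have [Ez|Nz] : uz = k \/ uz <> k by lia.
  subst uz; case: (adv_cases adv Gz) => [Gl|Gup|G'k].
  - exists i, j, u, iy, jy, uy, iz, (jz - 1), k; split=> //; last lia.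
    by split; [exact: adv_left Gl|lia|lia].
  - have H'up : H' (iz - 1) jz k by split; [exact: adv_up Gup|lia|lia].
    have [Cup|[Ei iiy]] : ((i <= iy /\ i < iz - 1) \/ (jz <= j /\ jy < j))
        \/ i = iz - 1 /\ i <= iy by lia.
    - by exists i, j, u, iy, jy, uy, (iz - 1), jz, k; split.
    have jjz : j < jz.
      have [//|jj] : j < jz \/ jz <= j by lia.
      by have := increases incG Gup Gx; lia.
    have jyj : jy < j.
      have [//|jj] : jy < j \/ j <= jy by lia.
      by have := increases incG Gx Gy; lia.
    have [w [Gw uw wx]] := between (r := iz) (s := jz - 1) Gx Gz ltac:(lia) ltac:(lia) ltac:(lia).
    have [Ew|Nw] : w = k - 1 \/ w <> k - 1 by lia.
      exists i, j, u, iy, jy, uy, iz, (jz - 1), k; split=> //; last lia.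
      by split; [apply: (adv_left adv Gz); rewrite -Ew|lia|lia].
    exists i, j, u, iy, jy, uy, iz, (jz - 1), w; split=> //; [|lia|lia].
    by apply: keep; [split=> //; lia|lia].
  - exists i, j, u, iy, jy, uy, iz, jz, k; split=> //.
    by split=> //; lia.
exists i, j, u, iy, jy, uy, iz, jz, uz; split=> //.
by apply: keep => //; lia.
Qed.

End Advance.

(** * A switch and its reverse *)

(** The full effect of switching the bullets of [G], equal to [k - 1], with the
    label [k].  A bullet or label without a partner next to it forms a component
    of one box and keeps its symbol; the bullets change from [k - 1] to [k + 1]
    because they have passed [k] in the order. *)
Record switches (k : Z) (G G' : placement) : Prop := Switches {
  sw_increasing : shifted_increasing G;
  sw_gap : forall i j, ~ G i j (k + 1);
  sw_keep : forall i j u, G i j u -> u <> k - 1 -> u <> k -> G' i j u;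
  sw_bullet : forall i j, G i j (k - 1) ->
    G i (j + 1) k \/ G (i + 1) j k -> G' i j k;
  sw_bullet_alone : forall i j, G i j (k - 1) ->
    (G i (j + 1) k \/ G (i + 1) j k) \/ G' i j (k + 1);
  sw_label : forall i j, G i j k ->
    G i (j - 1) (k - 1) \/ G (i - 1) j (k - 1) -> G' i j (k + 1);
  sw_label_alone : forall i j, G i j k ->
    (G i (j - 1) (k - 1) \/ G (i - 1) j (k - 1)) \/ G' i j k;
  sw_support : forall i j u, G' i j u -> exists v, G i j v;
  sw_functional : forall i j u v, G' i j u -> G' i j v -> u = v }.

Section Switch.
Variables (k : Z) (G G' : placement).
Hypothesis sw : switches k G G'.

Let incG := sw_increasing sw.

Variant switch_spec (i j u : Z) : Prop :=
  | SwitchKeep of G i j u & u <> k - 1 & u <> k & u <> k + 1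
  | SwitchBullet of u = k & G i j (k - 1) & G i (j + 1) k \/ G (i + 1) j k
  | SwitchBulletAlone of u = k + 1 & G i j (k - 1)
  | SwitchLabel of u = k + 1 & G i j k
      & G i (j - 1) (k - 1) \/ G (i - 1) j (k - 1)
  | SwitchLabelAlone of u = k & G i j k.

Lemma switchP i j u : G' i j u -> switch_spec i j u.
Proof.
move=> G'u; have [v Gv] := sw_support sw G'u.
have [Ev|Nv] : v = k - 1 \/ v <> k - 1 by lia.
  subst v; case: (sw_bullet_alone sw Gv) => [N|G'v].
    by apply: SwitchBullet => //; apply: (sw_functional sw G'u (sw_bullet sw Gv N)).
  exact: SwitchBulletAlone (sw_functional sw G'u G'v) Gv.
have [Ev|Nv'] : v = k \/ v <> k by lia.
  subst v; case: (sw_label_alone sw Gv) => [N|G'v].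
    by apply: SwitchLabel => //; apply: (sw_functional sw G'u (sw_label sw Gv N)).
  exact: SwitchLabelAlone (sw_functional sw G'u G'v) Gv.
have Eu := sw_functional sw G'u (sw_keep sw Gv Nv Nv'); subst u.
by apply: SwitchKeep => // E; subst v; exact: (sw_gap sw Gv).
Qed.

Lemma supported i j v : G i j v -> exists u, G' i j u.
Proof.
move=> Gv; have [Ev|Nv] : v = k - 1 \/ v <> k - 1 by lia.
  subst v; case: (sw_bullet_alone sw Gv) => [N|G'v]; last by exists (k + 1).
  by exists k; exact: (sw_bullet sw Gv N).
have [Ev|Nv'] : v = k \/ v <> k by lia.
  subst v; case: (sw_label_alone sw Gv) => [N|G'v]; last by exists k.
  by exists (k + 1); exact: (sw_label sw Gv N).
by exists v; exact: (sw_keep sw Gv Nv Nv').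
Qed.

(** A box strictly between the two would hold an entry strictly between [k - 1]
    and [k]. *)
Lemma consecutive_adjacent i j i' j' : G i j (k - 1) -> G i' j' k ->
  i <= i' -> j <= j' -> (i' = i /\ j' = j + 1) \/ (i' = i + 1 /\ j' = j).
Proof.
move=> Gb Gk ii jj.
have s1 := on_staircase incG Gb; have s2 := on_staircase incG Gk.
have [Ei|lti] : i' = i \/ i < i' by lia.
  subst i'; have [Ej|[Ej|ltj]] : j' = j \/ j' = j + 1 \/ j + 1 < j' by lia.
  - by subst j'; have := increases incG Gk Gb; lia.
  - by left.
  have [w Gw] := convex incG Gb Gk (r := i) (s := j + 1) ltac:(lia) ltac:(lia) ltac:(lia).
  have := increases incG Gb Gw; have := increases incG Gw Gk; lia.
have [Ej|ltj] : j' = j \/ j < j' by lia.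
  subst j'; have [Ei|lti'] : i' = i + 1 \/ i + 1 < i' by lia.
    by right.
  have [w Gw] := convex incG Gb Gk (r := i + 1) (s := j) ltac:(lia) ltac:(lia) ltac:(lia).
  have := increases incG Gb Gw; have := increases incG Gw Gk; lia.
have [w Gw] := convex incG Gb Gk (r := i) (s := j') ltac:(lia) ltac:(lia) ltac:(lia).
have := increases incG Gb Gw; have := increases incG Gw Gk; lia.
Qed.

Lemma switch_values i j u v : G i j v -> G' i j u ->
  (v <> k - 1 /\ v <> k /\ v <> k + 1 /\ u = v) \/
  (v = k - 1 \/ v = k) /\ (u = k \/ u = k + 1).
Proof.
have fG v1 : G i j v -> G i j v1 -> v = v1.
  by move=> Gv Gv1; have := increases incG Gv Gv1; have := increases incG Gv1 Gv; lia.
move=> Gv G'u; case: (switchP G'u) => [Gu ? ? ?|-> Gu _|-> Gu|-> Gu _|-> Gu];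
  have := fG _ Gv Gu; lia.
Qed.

(** Two comparable boxes can exchange the order of their entries only if they
    hold a bullet and [k]; they are then adjacent, and the switch reverses them
    in the same way as it reverses the order of the two symbols. *)
Lemma switch_increasing : shifted_increasing G'.
Proof.
split.
- move=> i j u /(sw_support sw)[v]; exact: on_staircase.
- move=> i j u i' j' u' r s /(sw_support sw)[v Gv] /(sw_support sw)[v' Gv'].
  move=> ri sj rs; have [w Gw] := convex incG Gv Gv' ri sj rs.
  exact: (supported Gw).
move=> i j u i' j' u' G'u G'u' ii jj.
have [[Ei Ej]|ne] : i = i' /\ j = j' \/ ~ (i = i' /\ j = j') by lia.
  by subst i' j'; rewrite (sw_functional sw G'u G'u'); lia.
have [v Gv] := sw_support sw G'u; have [v' Gv'] := sw_support sw G'u'.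
have [[Ev Ev']|nvv] : v = k - 1 /\ v' = k \/ ~ (v = k - 1 /\ v' = k) by lia.
  subst v v'; have adj := consecutive_adjacent Gv Gv' ii jj.
  have G'k : G' i j k.
    apply: (sw_bullet sw Gv).
    by case: adj => -[Ei Ej]; [left|right]; rewrite -Ei -Ej.
  have G'k1 : G' i' j' (k + 1).
    apply: (sw_label sw Gv').
    by case: adj => -[Ei Ej]; [left|right]; rewrite Ei Ej Z.add_simpl_r.
  by rewrite (sw_functional sw G'u G'k) (sw_functional sw G'u' G'k1); lia.
have := increases incG Gv Gv' ii jj.
by have := switch_values Gv G'u; have := switch_values Gv' G'u'; lia.
Qed.

Lemma switch_advances : advances k G G'.
Proof.
split=> //; first exact: (sw_keep sw).
- move=> i j Gk Gb; apply: (sw_bullet sw Gb); left.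
  by rewrite Z.sub_add.
- move=> i j Gk Gb; apply: (sw_bullet sw Gb); right.
  by rewrite Z.sub_add.
move=> i j Gk; case: (sw_label_alone sw Gk) => [[]|].
- by constructor 1.
- by constructor 2.
- by constructor 3.
Qed.

(** The reflected situation is again a switch: after negation the bullets of
    [G'] are just below the label [- k], and they move to where the bullets of
    [G] were. *)
Lemma switch_recedes : advances (- k) (dual G') (dual G).
Proof.
have Ek : - (- k - 1) = k + 1 by lia.
have sub1 i : - (i - 1) = - i + 1 by lia.
have slid i j i' j' : G' i j k -> G' i' j' (k + 1) ->
    i <= i' -> j <= j' -> i <> i' \/ j <> j' -> G i' j' k.
  move=> G'k G'b ii jj ne; case: (switchP G'b) => //; try lia.
  move=> _ Gb; have [v Gv] := sw_support sw G'k.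
  by have := switch_values Gv G'k; have := increases incG Gv Gb ii jj; lia.
rewrite /dual; split; rewrite ?Z.opp_involutive.
- exact: (dual_increasing switch_increasing).
- by move=> i j u G'u n1 n2; case: (switchP G'u) => //; lia.
- move=> i j; rewrite Ek sub1 => G'k G'b.
  by apply: (slid _ _ _ _ G'k G'b); lia.
- move=> i j; rewrite Ek sub1 => G'k G'b.
  by apply: (slid _ _ _ _ G'k G'b); lia.
move=> i j; rewrite Ek !sub1 => G'k.
case: (switchP G'k) => //; try lia; last by constructor 3.
move=> _ Gb [Gr|Gd].
- constructor 2; apply: (sw_label sw Gr); left.
  by rewrite Z.add_simpl_r.
- constructor 1; apply: (sw_label sw Gd); right.
  by rewrite Z.add_simpl_r.
Qed.

Lemma switch_gap i j : ~ G' i j (k - 1).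
Proof. by move=> G'u; case: (switchP G'u); lia. Qed.

End Switch.

Lemma numbers_dual e a b G i j u :
  dual (numbers e a b G) i j u <-> numbers (- e) (- b) (- a) (dual G) i j u.
Proof. by rewrite /dual /numbers; split=> -[Gu ne ab]; split=> //; lia. Qed.

Lemma dualK H i j u : dual (dual H) i j u -> H i j u.
Proof. by rewrite /dual !Z.opp_involutive. Qed.

Section Invariance.
Variables (k a b : Z) (G G' : placement).
Hypothesis sw : switches k G G'.

(* Statistics go back from G' to G by reflecting, advancing and reflecting. *)
Let back (P : placement -> Prop) :
    (forall H H' : placement, (forall i j u, H i j u -> H' i j u) -> P H -> P H') ->
    (forall H, P H -> P (dual H)) ->
    (P (numbers (- k - 1) (- b) (- a) (dual G')) ->
     P (numbers (- k + 1) (- b) (- a) (dual G))) ->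
  P (numbers (k + 1) a b G') -> P (numbers (k - 1) a b G).
Proof.
move=> Psub Pdual adv /Pdual PG'.
have {adv}/Pdual PG : P (numbers (- k + 1) (- b) (- a) (dual G)).
  apply: adv; apply: Psub PG' => i j u /numbers_dual.
  by have -> : - (k + 1) = - k - 1 by lia.
apply: Psub PG => i j u /numbers_dual.
have -> : - (- k + 1) = k - 1 by lia.
by rewrite !Z.opp_involutive => -[/dualK].
Qed.

Let dual_gap i j : ~ dual G' i j (- k + 1).
Proof.
rewrite /dual; have -> : - (- k + 1) = k - 1 by lia.
exact: (switch_gap sw).
Qed.

Lemma chain_switch l :
  chain (numbers (k - 1) a b G) l <-> chain (numbers (k + 1) a b G') l.
Proof.
split; first exact: (chain_advance (switch_advances sw) (sw_gap sw)).
apply: (@back (fun H => chain H l)).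
- by move=> H H'; exact: chain_sub.
- by move=> H; exact: chain_dual.
- exact: (chain_advance (switch_recedes sw) dual_gap).
Qed.

Lemma spread_switch :
  spread (numbers (k - 1) a b G) <-> spread (numbers (k + 1) a b G').
Proof.
split; first exact: (spread_advance (switch_advances sw) (sw_gap sw)).
apply: (@back spread).
- exact: spread_sub.
- exact: spread_dual.
- exact: (spread_advance (switch_recedes sw) dual_gap).
Qed.

End Invariance.

(** * Straight tableaux are determined by the statistics *)

Definition within (a b : Z) (H : placement) : placement :=
  fun i j u => H i j u /\ a <= u <= b.

Definition same_statistics (G G' : placement) : Prop := forall a b,
  (forall l, chain (within a b G) l <-> chain (within a b G') l) /\
  (spread (within a b G) <-> spread (within a b G')).

(** Rows are counted from 0; [str_closed] says that the filled boxes form a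
    straight shifted diagram. *)
Record straight (G : placement) : Prop := Straight {
  str_increasing : shifted_increasing G;
  str_row : forall i j u, G i j u -> 0 <= i;
  str_closed : forall i j u i' j', G i j u -> 0 <= i' <= i -> j' <= j ->
    i' <= j' -> exists w, G i' j' w }.

Lemma functional G i j u v : shifted_increasing G -> G i j u -> G i j v -> u = v.
Proof.
move=> inc Gu Gv; have := increases inc Gu Gv; have := increases inc Gv Gu; lia.
Qed.

Lemma descent_last_row (H : placement) r p i t :
  (forall i j u, H i j u -> r <= i) -> descent H p.+1 i t ->
  exists r' c u, [/\ H r' c u, r + Z.of_nat p <= r', u < t & r' < i].
Proof.
move=> low; elim: p i t => [|p IH] i t [r' [c [u [Hu ri ut D]]]].
  by exists r', c, u; split=> //; have := low _ _ _ Hu; lia.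
by have [r1 [c1 [u1 [Hu1 lo uu rr]]]] := IH _ _ D; exists r', c, u; split=> //; lia.
Qed.

Lemma ascent_last_column (H : placement) q j s : ascent H q.+1 j s ->
  exists r c u, [/\ H r c u, j + Z.of_nat q < c & s < u].
Proof.
elim: q j s => [|q IH] j s [r [c [u [Hu jc su A]]]].
  by exists r, c, u; split=> //; lia.
by have [r1 [c1 [u1 [Hu1 lo uu]]]] := IH _ _ A; exists r1, c1, u1; split=> //; lia.
Qed.

(** A chain is no longer than row [r]: its first phase of [p] entries ends in
    row [r + p - 1] or below, so its second phase starts to the right of column
    [r + p - 1], as the boxes up to that column with larger entries would be
    northwest of the end of the first phase.  Thus a chain of [l + 1] entries
    reaches column [r + l] at least, and the entry of row [r] in that column is
    at most the last entry of the chain.  Conversely row [r] itself is a chain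
    without first phase. *)
Lemma chain_first_row G r m b l : straight G -> 0 <= r ->
  (forall i j u, G i j u -> r <= i <-> m < u) ->
  chain (within (m + 1) b G) l.+1 <->
  exists u, G r (r + Z.of_nat l) u /\ u <= b.
Proof.
move=> str r0 rowm; set H := within _ _ _; have incG := str_increasing str.
have low i j u : H i j u -> r <= i.
  by case=> Gu mb; apply/(rowm _ _ _ Gu); lia.
have reach i j u : H i j u -> r + Z.of_nat l <= j ->
    exists u, G r (r + Z.of_nat l) u /\ u <= b.
  move=> Hu lj; have ri := low _ _ _ Hu; have [Gu mb] := Hu.
  have [w Gw] := str_closed str Gu (i' := r) (j' := r + Z.of_nat l) ltac:(lia) lj ltac:(lia).
  by exists w; split=> //; have := increases incG Gw Gu ri lj; lia.
split=> [[p [q [i [j [t [s [El D A ts]]]]]]]|[u [Gu ub]]].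
  case: p El D => [|p] El D.
    case: q El A => // q El [r1 [c1 [u1 [Hu1 jc su A]]]].
    have c1r : r <= c1.
      by have := low _ _ _ Hu1; case: Hu1 => /(on_staircase incG); lia.
    have {}A : ascent H q.+1 (r - 1) (u1 - 1).
      by exists r1, c1, u1; split=> //; lia.
    have [r2 [c2 [u2 [Hu2 lo uu]]]] := ascent_last_column A.
    by apply: (reach _ _ _ Hu2); lia.
  have [r1 [c1 [u1 [Hu1 lo1 uu1 rr1]]]] := descent_last_row low D.
  have [Gu1 mb1] := Hu1; have rc1 := on_staircase incG Gu1.
  case: q El A => [|q] El A; first by apply: (reach _ _ _ Hu1); lia.
  have {}A : ascent H q.+1 r1 s.
    case: A => r2 [c2 [u2 [Hu2 jc2 su2 A]]]; exists r2, c2, u2; split=> //.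
    have [//|cc] : r1 < c2 \/ c2 <= r1 by lia.
    have [Gu2 mb2] := Hu2; have rc2 := on_staircase incG Gu2.
    by have := increases incG Gu2 Gu1 ltac:(lia) ltac:(lia); lia.
  have [r2 [c2 [u2 [Hu2 lo uu]]]] := ascent_last_column A.
  by apply: (reach _ _ _ Hu2); lia.
have H_row x w : (x <= l)%N -> G r (r + Z.of_nat x) w -> H r (r + Z.of_nat x) w.
  move=> xl Gw; split=> //; have := increases incG Gw Gu ltac:(lia) ltac:(lia).
  by have := rowm _ _ _ Gw; lia.
have IH y x w : (x + y = l)%N -> G r (r + Z.of_nat x) w -> ascent H y (r + Z.of_nat x) w.
  elim: y x w => //= y IHy x w xy Gw.
  have [w' Gw'] := str_closed str Gu (i' := r) (j' := r + Z.of_nat x.+1) ltac:(lia) ltac:(lia) ltac:(lia).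
  exists r, (r + Z.of_nat x.+1), w'; split; [|lia| |].
  - by apply: H_row Gw'; lia.
  - by have := increases incG Gw Gw'; lia.
  - by apply: IHy Gw'; lia.
have [w Gw] := str_closed str Gu (i' := r) (j' := r) ltac:(lia) ltac:(lia) ltac:(lia).
have Gw0 : G r (r + Z.of_nat 0) w by rewrite Z.add_0_r.
exists 0%N, l.+1, r, (r - 1), m, m; split=> //; last lia.
exists r, (r + Z.of_nat 0), w; split; [exact: H_row|lia| |exact: IH].
by have := rowm _ _ _ Gw; lia.
Qed.

Lemma row_bound (M : nat -> Z) (r s : nat) :
  (forall r, M r <= M r.+1) -> (r <= s)%N -> M r <= M s.
Proof.
move=> mono; elim: s => [|s IH]; first by case: r => //; lia.
rewrite leq_eqVlt => /orP[/eqP-> //|]; first lia.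
by move/IH; have := mono s; lia.
Qed.

(** Row [r] of [G] has all its entries in the interval from [M r] (excluded) to
    [M r.+1].  By induction on [r] the rows above row [r] agree and the others
    of [G'] lie above [M r], so that [chain_first_row] makes row [r] agree.  If
    some later entry of [G'] were at most [M r.+1], then so would be the
    diagonal entry of row [r + 1], which would make a spread with the first two
    entries of row [r]; but [G] has no spread within one row. *)
Lemma rigid G G' (M : nat -> Z) :
  straight G -> straight G' -> same_statistics G G' ->
  (forall r, M r <= M r.+1) ->
  (forall r j u, G (Z.of_nat r) j u -> M r < u <= M r.+1) ->
  forall i j u, G i j u <-> G' i j u.
Proof.
move=> str str' same mono rowM.
have incG := str_increasing str; have incG' := str_increasing str'.
have rowG r i j u : G i j u -> Z.of_nat r <= i <-> M r < u.
  move=> Gu; have := rowM (Z.to_nat i) j u; have i0 := str_row str Gu.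
  rewrite Z2Nat.id // => /(_ Gu) bd; split=> ri.
    by have := row_bound (r := r) (s := Z.to_nat i) mono ltac:(lia); lia.
  have [//|ir] : Z.of_nat r <= i \/ i < Z.of_nat r by lia.
  by have := row_bound (r := (Z.to_nat i).+1) (s := r) mono ltac:(lia); lia.
suff main (r : nat) : (forall i j u, i < Z.of_nat r -> G i j u <-> G' i j u) /\
    (forall i j u, Z.of_nat r <= i -> G' i j u -> M r < u).
  move=> i j u; have [agree _] := main (Z.to_nat i).+1.
  have [lt|ge] : i < Z.of_nat (Z.to_nat i).+1 \/ i < 0 by lia.
    exact: agree.
  by split=> [/(str_row str)|/(str_row str')]; lia.
elim: r => [|r [agree above]].
  split=> [i j u i0|i j u i0 G'u].
    by split=> [/(str_row str)|/(str_row str')]; lia.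
  (* Chains of length 1 in [[u, u]] detect the entry u, so G' has only entries
     that occur in G, which are all above M 0. *)
  have : chain (within u u G') 1.
    exists 0%N, 1%N, 0, (j - 1), (u - 1), (u - 1); split=> //; last lia.
    by exists i, j, u; split=> //; [split=> //|..]; lia.
  case/((same u u).1 1%N) => p [q [? [? [t [s [El D A _]]]]]].
  have [r1 [c1 [v [Gv uv]]]] : exists r1 c1 v, within u u G r1 c1 v.
    case: p El D => [|p] El; last by case=> r1 [c1 [v [Gv *]]]; exists r1, c1, v.
    case: q El A => // q El; by case=> r1 [c1 [v [Gv *]]]; exists r1, c1, v.
  have := rowG 0%N _ _ _ Gv; have := str_row str Gv; lia.
have rowG' i j u : G' i j u -> Z.of_nat r <= i <-> M r < u.
  move=> G'u; split=> ri; first exact: above G'u.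
  have [//|ir] : Z.of_nat r <= i \/ i < Z.of_nat r by lia.
  by move/agree/(rowG r): G'u => /(_ ir); lia.
have r0 : 0 <= Z.of_nat r by lia.
have sameP b l :
    (exists u, G (Z.of_nat r) (Z.of_nat r + Z.of_nat l) u /\ u <= b) <->
    (exists u, G' (Z.of_nat r) (Z.of_nat r + Z.of_nat l) u /\ u <= b).
  rewrite -(chain_first_row _ _ str r0 (rowG r)).
  rewrite -(chain_first_row _ _ str' r0 rowG').
  exact: ((same (M r + 1) b).1 l.+1).
have agree_row l u : G (Z.of_nat r) (Z.of_nat r + Z.of_nat l) u <->
                     G' (Z.of_nat r) (Z.of_nat r + Z.of_nat l) u.
  split=> [Gu|Gu].
    have /sameP[v [Gv vu]] : exists v, G (Z.of_nat r) (Z.of_nat r + Z.of_nat l) v /\ v <= u.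
      by exists u; split=> //; lia.
    have /sameP[w [Gw wv]] : exists w, G' (Z.of_nat r) (Z.of_nat r + Z.of_nat l) w /\ w <= v.
      by exists v; split=> //; lia.
    have E := functional incG Gu Gw; subst w.
    by have -> : u = v by lia.
  have /sameP[v [Gv vu]] : exists v, G' (Z.of_nat r) (Z.of_nat r + Z.of_nat l) v /\ v <= u.
    by exists u; split=> //; lia.
  have /sameP[w [Gw wv]] : exists w, G (Z.of_nat r) (Z.of_nat r + Z.of_nat l) w /\ w <= v.
    by exists v; split=> //; lia.
  have E := functional incG' Gu Gw; subst w.
  by have -> : u = v by lia.
split; last first.
  move=> i j u ri G'u.
  have [//|um] : M r.+1 < u \/ u <= M r.+1 by lia.
  have ij := on_staircase incG' G'u.
  set R := Z.of_nat r in ri r0 *.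
  have [z Gz] := str_closed str' G'u (i' := R + 1) (j' := R + 1) ltac:(lia) ltac:(lia) ltac:(lia).
  have [x Gx] := str_closed str' Gz (i' := R) (j' := R + 1) ltac:(lia) ltac:(lia) ltac:(lia).
  have [y Gy] := str_closed str' Gx (i' := R) (j' := R) ltac:(lia) ltac:(lia) ltac:(lia).
  have yM := above _ _ _ (Z.le_refl R) Gy.
  have yx := increases incG' Gy Gx; have xz := increases incG' Gx Gz.
  have zu := increases incG' Gz G'u.
  (* x, y, z are the entries at (R, R + 1), (R, R), (R + 1, R + 1). *)
  have : spread (within (M r + 1) (M r.+1) G').
    exists R, (R + 1), x, R, R, y, (R + 1), (R + 1), z.
    split; [split=> //; lia|split=> //; lia|split=> //; lia|lia|left; lia].
  case/((same _ _).2) => i1 [j1 [u1 [iy [jy [uy [iz [jz [uz]]]]]]]].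
  have row_r i2 j2 u2 : within (M r + 1) (M r.+1) G i2 j2 u2 -> i2 = R.
    case=> Gu2 bd; have := rowG r _ _ _ Gu2; have := rowG r.+1 _ _ _ Gu2; lia.
  case=> Hx Hy Hz uu C.
  have := row_r _ _ _ Hx; have := row_r _ _ _ Hy; have := row_r _ _ _ Hz => Ez Ey Ex.
  case: C => C; first lia.
  by have := increases incG Hz.1 Hx.1; lia.
move=> i j u ir.
have [Ei|lt] : i = Z.of_nat r \/ i < Z.of_nat r by lia.
  subst i; have Ej : Z.of_nat r <= j -> j = Z.of_nat r + Z.of_nat (Z.to_nat (j - Z.of_nat r)).
    lia.
  split=> Gu.
    have jr := on_staircase incG Gu; rewrite (Ej jr) in Gu *.
    exact/agree_row.
  have jr := on_staircase incG' Gu; rewrite (Ej jr) in Gu *.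
  exact/agree_row.
exact: agree.
Qed.

End Placements.

(** * Fillings as placements *)

Section Fillings.
Variable n : nat.
Implicit Types (c d : box n) (U V x : {set box n}).
Implicit Types (T : tableau n) (F : filling n symbol).

Definition entries (f : box n -> option Z) : placement := fun i j u =>
  exists c, [/\ Z.of_nat c.1 = i, Z.of_nat c.2 = j & f c = Some u].

(** Labels become even numbers, so that bullets can be given any place among
    them by an odd key. *)
Definition label_key (k : nat) : Z := (2 * Z.of_nat k)%Z.
Definition key (e : Z) (s : symbol) : Z := if s is inr k then label_key k else e.

Definition cells e F : placement := entries (fun c => omap (key e) (F c)).
Definition tab T : placement := entries (fun c => omap label_key (T c)).

Lemma box_eq c d : c.1 = d.1 :> nat -> c.2 = d.2 :> nat -> c = d.
Proof. by case: c d => [i j] [i' j'] /= /ord_inj-> /ord_inj->. Qed.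

Lemma box_at r s : r < n -> s < n -> exists c, c.1 = r :> nat /\ c.2 = s :> nat.
Proof. by move=> rn sn; exists (Ordinal rn, Ordinal sn). Qed.

Lemma entries_box f c u : entries f (Z.of_nat c.1) (Z.of_nat c.2) u -> f c = Some u.
Proof. by case=> d [E1 E2 <-]; congr f; apply: box_eq; lia. Qed.

Definition precedes c d := (c.1 <= d.1) && (c.2 <= d.2).

(** The shifted diagrams, described by closure under going up and left within
    the staircase.  Both the inner and the outer shape of a tableau remain
    ideals during a slide, so partitions are not followed any further. *)
Definition ideal U := (forall c, c \in U -> c.1 <= c.2) /\
  (forall c d, d \in U -> precedes c d -> c.1 <= c.2 -> c \in U).

Lemma entries_increasing f U V : ideal U -> ideal V ->
  (forall c, isSome (f c) = (c \in U :\: V)) ->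
  (forall c d u v, f c = Some u -> f d = Some v -> precedes c d -> c <> d -> (u < v)%Z) ->
  shifted_increasing (entries f).
Proof.
move=> [Uup Ulow] [Vup Vlow] supp inc; split.
- move=> i j u [c [<- <- fc]].
  have /Uup : c \in U by move: (supp c); rewrite fc inE => /esym/andP[].
  lia.
- move=> i j u i' j' u' r s [c [Ec1 Ec2 fc]] [d [Ed1 Ed2 fd]] ri sj rs.
  have rn : Z.to_nat r < n by have := ltn_ord d.1; lia.
  have sn : Z.to_nat s < n by have := ltn_ord d.2; lia.
  have [e [Er Es]] := box_at rn sn.
  have : isSome (f e).
    have dU : d \in U by move: (supp d); rewrite fd inE => /esym/andP[].
    have cV : c \notin V by move: (supp c); rewrite fc inE => /esym/andP[].
    rewrite supp inE (Ulow e d) ?andbT //; [|rewrite /precedes; lia|lia].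
    have cU : c \in U by move: (supp c); rewrite fc inE => /esym/andP[].
    apply: contra cV => eV; apply: (Vlow c e) => //; last exact: Uup.
    by rewrite /precedes; lia.
  case E : (f e) => [w|//] _; exists w, e; split=> //; lia.
- move=> i j u i' j' u' [c [Ec1 Ec2 fc]] [d [Ed1 Ed2 fd]] ri sj.
  have [E|ne] := eqVneq c d.
    by right; subst d; rewrite fc in fd; case: fd; lia.
  left; apply: (inc _ _ _ _ fc fd); last exact/eqP.
  by rewrite /precedes; lia.
Qed.

Lemma adjacentE c d : adjacent c d <->
  (c.1 = d.1 :> nat /\ (d.2 = c.2.+1 :> nat \/ c.2 = d.2.+1 :> nat)) \/
  (c.2 = d.2 :> nat /\ (d.1 = c.1.+1 :> nat \/ c.1 = d.1.+1 :> nat)).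
Proof. by rewrite /adjacent /is_right /is_below -!(inj_eq (@ord_inj n)); lia. Qed.

Lemma adjacent_neq c d : adjacent c d -> c <> d.
Proof. by move=> /adjacentE adj E; subst d; lia. Qed.

(** [switch] leaves a component of one box unchanged; whether a box is one can
    be read off its neighbours. *)
Lemma component_gt1 (A : {set box n}) c : c \in A ->
  reflect (exists2 d, d \in A & adjacent c d) (1 < #|component A c|).
Proof.
move=> cA; apply: (iffP idP) => [|[d dA cd]].
  rewrite (cardsD1 c) inE connect0 add1n ltnS card_gt0 => /set0Pn[d].
  rewrite !inE => /andP[dc /connectP[[|e p] /= ]]; first by move=> _ E; rewrite E eqxx in dc.
  by case/andP=> /and3P[_ eA ce] _ _; exists e.
rewrite (cardsD1 c) inE connect0 add1n ltnS card_gt0; apply/set0Pn; exists d.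
rewrite !inE; have cd' := adjacent_neq cd.
rewrite connect1 ?cA ?dA // andbT; apply/eqP=> E; exact: cd'.
Qed.

Lemma omap_key e F c u : omap (key e) (F c) = Some u ->
  exists2 s, F c = Some s & key e s = u.
Proof. by case: (F c) => //= s [<-]; exists s. Qed.

Section SwitchFilling.
Variables (k : nat) (F : filling n symbol).
Let kk := label_key k.
Hypothesis incF : shifted_increasing (cells (kk - 1) F).
Let F' := switch bullet (label k) F.
Let A := [set c | (F c == Some bullet) || (F c == Some (label k))].

Lemma key_bullet s : key (kk - 1) s = (kk - 1)%Z -> s = bullet.
Proof. by case: s => [[]|v] //=; rewrite /kk /label_key; lia. Qed.

Lemma key_label s : key (kk - 1) s = kk -> s = label k.
Proof.
case: s => [[]|v] /=; rewrite /kk /label_key; first lia.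
by move=> E; congr inr; lia.
Qed.

Lemma cellsF e c s : F c = Some s -> cells e F (Z.of_nat c.1) (Z.of_nat c.2) (key e s).
Proof. by move=> Fc; exists c; rewrite Fc. Qed.

Lemma keyb e : key e bullet = e. Proof. by []. Qed.

Lemma keyl e v : key e (label v) = label_key v. Proof. by []. Qed.

(** Of two adjacent boxes that hold a bullet or [k], the one to the left or above
    holds the bullet, because bullets are just below [k] in the order. *)
Lemma bullet_moves c : F c = Some bullet ->
  (1 < #|component A c|) <->
  (cells (kk - 1) F (Z.of_nat c.1) (Z.of_nat c.2 + 1) kk \/
   cells (kk - 1) F (Z.of_nat c.1 + 1) (Z.of_nat c.2) kk)%Z.
Proof.
move=> Fc; have cA : c \in A by rewrite inE Fc eqxx.
split=> [/(component_gt1 cA)[d dA cd]|adj].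
  have [s Fd] : exists s, F d = Some s by move: dA; rewrite inE => /orP[/eqP->|/eqP->]; eexists.
  have Gc := cellsF (kk - 1) Fc; have Gd := cellsF (kk - 1) Fd.
  have := increases incF Gc Gd; have := increases incF Gd Gc.
  rewrite ?keyb ?keyl => dc cd1.
  move/adjacentE: cd => adj.
  have Es : key (kk - 1) s = kk.
    move: dA dc cd1; rewrite inE Fd => /orP[/eqP[->]|/eqP[->]] //;
      by rewrite ?keyb ?keyl /kk; lia.
  rewrite Es in Gd dc cd1.
  have [[E1 E2]|[E1 E2]] : (d.1 = c.1 :> nat /\ d.2 = c.2.+1 :> nat) \/
    (d.1 = c.1.+1 :> nat /\ d.2 = c.2 :> nat) by lia.
  - left; rewrite E1 E2 in Gd; by have <- : (Z.of_nat c.2.+1 = Z.of_nat c.2 + 1)%Z by lia.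
  - right; rewrite E1 E2 in Gd; by have <- : (Z.of_nat c.1.+1 = Z.of_nat c.1 + 1)%Z by lia.
apply/(component_gt1 cA).
case: adj => -[d [E1 E2 /omap_key[s Fd /key_label Es]]]; exists d;
  rewrite ?inE ?Fd ?Es ?eqxx ?orbT //; apply/adjacentE; lia.
Qed.

Lemma label_moves c : F c = Some (label k) ->
  (1 < #|component A c|) <->
  (cells (kk - 1) F (Z.of_nat c.1) (Z.of_nat c.2 - 1) (kk - 1) \/
   cells (kk - 1) F (Z.of_nat c.1 - 1) (Z.of_nat c.2) (kk - 1))%Z.
Proof.
move=> Fc; have cA : c \in A by rewrite inE Fc eqxx orbT.
split=> [/(component_gt1 cA)[d dA cd]|adj].
  have [s Fd] : exists s, F d = Some s by move: dA; rewrite inE => /orP[/eqP->|/eqP->]; eexists.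
  have Gc := cellsF (kk - 1) Fc; have Gd := cellsF (kk - 1) Fd.
  have := increases incF Gc Gd; have := increases incF Gd Gc.
  rewrite ?keyb ?keyl => dc cd1.
  move/adjacentE: cd => adj.
  have Es : key (kk - 1) s = (kk - 1)%Z.
    move: dA dc cd1; rewrite inE Fd => /orP[/eqP[->]|/eqP[->]] //;
      by rewrite ?keyb ?keyl /kk; lia.
  rewrite Es in Gd dc cd1.
  have [[E1 E2]|[E1 E2]] : (c.1 = d.1 :> nat /\ c.2 = d.2.+1 :> nat) \/
    (c.1 = d.1.+1 :> nat /\ c.2 = d.2 :> nat) by rewrite /kk in dc cd1; lia.
  - left; rewrite E1 E2; by have -> : (Z.of_nat d.2.+1 - 1 = Z.of_nat d.2)%Z by lia.
  - right; rewrite E1 E2; by have -> : (Z.of_nat d.1.+1 - 1 = Z.of_nat d.1)%Z by lia.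
apply/(component_gt1 cA).
case: adj => -[d [E1 E2 /omap_key[s Fd /key_bullet Es]]]; exists d;
  rewrite ?inE ?Fd ?Es ?eqxx ?orbT //; apply/adjacentE; lia.
Qed.

Lemma switchE c : F' c =
  if F c == Some bullet then
    if 1 < #|component A c| then Some (label k) else Some bullet
  else if F c == Some (label k) then
    if 1 < #|component A c| then Some bullet else Some (label k)
  else F c.
Proof.
rewrite /F' /switch ffunE inE -/A.
have [->|nb] := eqVneq (F c) (Some bullet); first by rewrite /=; case: ifP => _; rewrite /= /swap /= ?eqxx.
by have [->|nl] := eqVneq (F c) (Some (label k)); first by rewrite /=; case: ifP => _; rewrite /= /swap /= ?eqxx.
Qed.

Lemma switch_switches : switches kk (cells (kk - 1) F) (cells (kk + 1) F').
Proof.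
split=> //.
- by move=> i j [c [_ _ /omap_key[[[]|v] _ /=]]]; rewrite /kk /label_key; lia.
- move=> i j u [c [<- <- /omap_key[s Fc Es]]] n1 n2; exists c; split=> //.
  rewrite switchE Fc; case: s Es Fc => [[]|v] /= Es Fc; first by case: n1.
  have [Ev|nv] := eqVneq v k; first by case: n2; rewrite -Es Ev.
  case: ifP => [/eqP[E]|_]; first by rewrite E eqxx in nv.
  by rewrite -Es.
- move=> i j [c [<- <- /omap_key[s Fc /key_bullet Es]]]; subst s.
  move/(bullet_moves Fc) => mv; exists c; split=> //.
  by rewrite switchE Fc eqxx mv.
- move=> i j [c [<- <- /omap_key[s Fc /key_bullet Es]]]; subst s.
  case: (boolP (1 < #|component A c|)) => [/(bullet_moves Fc)|mv]; first by left.
  by right; exists c; split=> //; rewrite switchE Fc eqxx (negPf mv).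
- move=> i j [c [<- <- /omap_key[s Fc /key_label Es]]]; subst s.
  move/(label_moves Fc) => mv; exists c; split=> //.
  by rewrite switchE Fc eqxx mv.
- move=> i j [c [<- <- /omap_key[s Fc /key_label Es]]]; subst s.
  case: (boolP (1 < #|component A c|)) => [/(label_moves Fc)|mv]; first by left.
  by right; exists c; split=> //; rewrite switchE Fc eqxx (negPf mv).
- move=> i j u [c [<- <- /omap_key[s F'c Es]]].
  have [t Fc] : exists t, F c = Some t.
    by move: F'c; rewrite switchE; case: (F c) => [t _|//]; exists t.
  by exists (key (kk - 1) t); exact: cellsF.
- move=> i j u v [c [<- <- F'c]] /entries_box E.
  by rewrite F'c in E; case: E.
Qed.

End SwitchFilling.

(** * Slides and rectifications *)

Lemma same_sym G1 G2 : same_statistics G1 G2 -> same_statistics G2 G1.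
Proof. by move=> S a b; split=> [l|]; [rewrite (S a b).1|rewrite (S a b).2]. Qed.

Lemma same_trans G1 G2 G3 :
  same_statistics G1 G2 -> same_statistics G2 G3 -> same_statistics G1 G3.
Proof.
move=> S1 S2 a b; split=> [l|].
  by rewrite (S1 a b).1 (S2 a b).1.
by rewrite (S1 a b).2 (S2 a b).2.
Qed.

Definition odd_key e := exists z, e = (2 * z + 1)%Z.

Lemma numbers_cells e a b F i j u : odd_key e ->
  numbers e a b (cells e F) i j u <-> within a b (tab (delete_bullets F)) i j u.
Proof.
move=> [z Ez]; split.
  case=> -[c [Ei Ej /omap_key[s Fc Es]]] ne ab; split=> //; exists c; split=> //.
  rewrite ffunE Fc; case: s Es {Fc} => [[]|v] /= Es; first by case: ne.
  by rewrite Es.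
case=> -[c [Ei Ej]]; rewrite ffunE; case Fc : (F c) => [[[]|v]|] //= [Eu] ab.
split=> //; first by exists c; rewrite Fc /= Eu.
by rewrite Ez -Eu /label_key; lia.
Qed.

Lemma switch_statistics k F :
  shifted_increasing (cells (label_key k - 1) F) ->
  same_statistics (tab (delete_bullets F))
                  (tab (delete_bullets (switch bullet (label k) F))).
Proof.
move=> inc; have sw := switch_switches inc; move: sw; set F' := switch _ _ _ => sw.
have odd1 : odd_key (label_key k - 1).
  by exists (Z.of_nat k - 1)%Z; rewrite /label_key; lia.
have odd2 : odd_key (label_key k + 1) by exists (Z.of_nat k); rewrite /label_key; lia.
move=> a b; split=> [l|].
  have [fw bw] := chain_switch a b sw l; split=> C.
    apply: (@chain_sub (numbers (label_key k + 1) a b (cells (label_key k + 1) F'))).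
      by move=> i j u /(numbers_cells _ _ _ _ _ _ odd2).
    by apply: fw; apply: chain_sub C => i j u /(numbers_cells _ _ _ _ _ _ odd1).
  apply: (@chain_sub (numbers (label_key k - 1) a b (cells (label_key k - 1) F))).
    by move=> i j u /(numbers_cells _ _ _ _ _ _ odd1).
  by apply: bw; apply: chain_sub C => i j u /(numbers_cells _ _ _ _ _ _ odd2).
have [fw bw] := spread_switch a b sw; split=> C.
  apply: (@spread_sub (numbers (label_key k + 1) a b (cells (label_key k + 1) F'))).
    by move=> i j u /(numbers_cells _ _ _ _ _ _ odd2).
  by apply: fw; apply: spread_sub C => i j u /(numbers_cells _ _ _ _ _ _ odd1).
apply: (@spread_sub (numbers (label_key k - 1) a b (cells (label_key k - 1) F))).
  by move=> i j u /(numbers_cells _ _ _ _ _ _ odd1).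
by apply: bw; apply: spread_sub C => i j u /(numbers_cells _ _ _ _ _ _ odd2).
Qed.

(** Between two consecutive labels all keys of the bullets give the same order.
    This links the end of one switch to the start of the next. *)
Lemma cells_rekey e e' F : shifted_increasing (cells e F) ->
  (forall c v, F c = Some (label v) ->
     (e < label_key v <-> e' < label_key v)%Z /\
     (label_key v < e <-> label_key v < e')%Z) ->
  shifted_increasing (cells e' F).
Proof.
move=> inc cmp.
have recell i j u : cells e' F i j u -> exists v, cells e F i j v.
  by case=> c [Ei Ej /omap_key[s Fc _]]; exists (key e s); exists c; rewrite Fc.
split.
- by move=> i j u /recell[v]; exact: on_staircase.
- move=> i j u i' j' u' r s /recell[v Gv] /recell[v' Gv'] ri sj rs.
  have [w [c [Er Es /omap_key[t Fc _]]]] := convex inc Gv Gv' ri sj rs.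
  by exists (key e' t); exists c; rewrite Fc.
move=> i j u i' j' u' [c [Ei Ej /omap_key[s Fc Eu]]] [d [Ei' Ej' /omap_key[t Fd Eu']]] ii jj.
have Gc : cells e F i j (key e s) by exists c; rewrite Fc.
have Gd : cells e F i' j' (key e t) by exists d; rewrite Fd.
case: (increases inc Gc Gd ii jj) => [lt|[E1 [E2 E3]]].
  left; rewrite -Eu -Eu'.
  case: s t lt Fc Fd {Gc Gd Eu Eu'} => [[]|v] [[]|w] /= lt Fc Fd //; first lia.
  - by have := cmp _ _ Fd; lia.
  - by have := cmp _ _ Fc; lia.
right; split=> //; split=> //.
have cd : c = d by apply: box_eq; lia.
by subst d; rewrite Fc in Fd; case: Fd => Est; rewrite -Eu -Eu' Est.
Qed.

Lemma isSome_switch k F c : isSome (switch bullet (label k) F c) = isSome (F c).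
Proof. by rewrite /switch ffunE; case: ifP => _ //; case: (F c). Qed.

Lemma label_switch k F c v : switch bullet (label k) F c = Some (label v) ->
  v = k \/ F c = Some (label v).
Proof.
rewrite switchE; case: ifP => _; first by case: ifP => // _ [->]; left.
case: ifP => [/eqP Fc|_]; last by right.
by case: ifP => // _ [->]; left.
Qed.

Lemma slide_labels ks e F : sorted ltn ks -> shifted_increasing (cells e F) ->
  (forall k, k \in ks -> e < label_key k)%Z ->
  (forall c v, F c = Some (label v) -> label_key v < e \/ v \in ks)%Z ->
  exists e', let F' := foldl (fun F k => switch bullet (label k) F) F ks in
  [/\ shifted_increasing (cells e' F'),
      forall c v, F' c = Some (label v) -> (label_key v < e')%Z,
      forall c, isSome (F' c) = isSome (F c) &
      same_statistics (tab (delete_bullets F)) (tab (delete_bullets F'))].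
Proof.
elim: ks e F => [|k ks IH] e F /= srt inc high lab.
  by exists e; split=> // c v /lab[].
have lek m : m \in ks -> k < m.
  by move=> mks; have /allP/(_ m mks) := order_path_min ltn_trans srt.
have ek := high k (mem_head _ _).
have inck : shifted_increasing (cells (label_key k - 1) F).
  apply: cells_rekey inc _ => c v /lab[lt|]; first lia.
  rewrite inE => /orP[/eqP-> |/[dup] vks /lek]; first lia.
  have := high v; rewrite inE vks orbT => /(_ isT); rewrite /label_key; lia.
have sw := switch_switches inck.
have incF' := switch_increasing sw.
case: (IH (label_key k + 1)%Z _ (path_sorted srt) incF') => [m /lek|c v /label_switch[->|/lab[lt|]]|].
- by rewrite /label_key; lia.
- by left; lia.
- by left; lia.
- rewrite inE => /orP[/eqP->|]; [left; lia|by right].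
move=> e' [inc' lt' supp' same']; exists e'; split=> //.
  by move=> c; rewrite supp' isSome_switch.
exact: same_trans (switch_statistics inck) same'.
Qed.

(** [U] is the outer and [V] the inner shape. *)
Record skew_tableau U V T : Prop := SkewTableau {
  outer_ideal : ideal U;
  inner_ideal : ideal V;
  inner_sub : V \subset U;
  skew_support : forall c, isSome (T c) = (c \in U :\: V);
  skew_increasing : shifted_increasing (tab T) }.

(** A box of [V] strictly southeast of [c] would force the box to the right of or
    below [c] into [V]. *)
Lemma corner_maximal V x c d : ideal V -> x \subset inner_corners V ->
  c \in x -> d \in V -> precedes c d -> c = d.
Proof.
move=> [Vup Vlow] /subsetP sub /sub; rewrite inE => /andP[cV /forallP corner] dV.
rewrite /precedes => cd; have dd := Vup _ dV; have cc := Vup _ cV.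
have free e : precedes e d -> e.1 <= e.2 ->
    ~ (e.1 = c.1 :> nat /\ e.2 = c.2.+1 :> nat \/
       e.1 = c.1.+1 :> nat /\ e.2 = c.2 :> nat).
  move=> ed ee ec; have := corner e; rewrite (Vlow e d) //=.
  by rewrite /is_right /is_below -!(inj_eq (@ord_inj n)); lia.
have [lt|le] := ltnP c.2 d.2.
  have [e [E1 E2]] := box_at (ltn_ord c.1) (leq_ltn_trans lt (ltn_ord d.2)).
  by case: (free e) => //; rewrite ?/precedes; lia.
have [lt|le'] := ltnP c.1 d.1.
  have [e [E1 E2]] := box_at (leq_ltn_trans lt (ltn_ord d.1)) (ltn_ord c.2).
  by case: (free e) => //; rewrite ?/precedes; lia.
by apply: box_eq; lia.
Qed.

Lemma ideal_corners V x : ideal V -> x \subset inner_corners V -> ideal (V :\: x).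
Proof.
move=> idV sub; have [Vup Vlow] := idV; split=> [c|c d].
  by rewrite inE => /andP[_ /Vup].
rewrite !inE => /andP[dx dV] cd cc; rewrite (Vlow c d) // andbT.
by apply: contra dx => cx; rewrite -(corner_maximal idV sub cx dV cd).
Qed.

Lemma entries_order (f : box n -> option Z) c d u v : shifted_increasing (entries f) ->
  f c = Some u -> f d = Some v -> precedes c d -> c <> d -> (u < v)%Z.
Proof.
move=> inc fc fd; rewrite /precedes => cd ne.
have Gc : entries f (Z.of_nat c.1) (Z.of_nat c.2) u by exists c.
have Gd : entries f (Z.of_nat d.1) (Z.of_nat d.2) v by exists d.
case: (increases inc Gc Gd) => //; try lia.
by move=> [E1 [E2 _]]; case: ne; apply: box_eq; lia.
Qed.

(** Bullets start below all labels, with key -1, which makes a tableau on the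
    outer shape minus the reduced inner shape.  They end above all labels, so
    deleting them leaves an ideal as outer shape. *)
Lemma slide U V x T : skew_tableau U V T -> x \subset inner_corners V ->
  exists U', skew_tableau U' (V :\: x) (Kjdt x T) /\
             same_statistics (tab T) (tab (Kjdt x T)).
Proof.
move=> sk sub; have [idU idV VU supp inc] := sk.
have idV' := ideal_corners idV sub.
have xV c : c \in x -> c \in V by move/(subsetP sub); rewrite inE => /andP[].
have Tx c : c \in x -> T c = None.
  by move/xV => cV; case E : (T c) => //; have := supp c; rewrite E inE cV.
set F := add_bullets x T.
have suppF c : isSome (F c) = (c \in U :\: (V :\: x)).
  rewrite ffunE !inE; case: ifP => [cx|ncx] /=.
    by rewrite (subsetP VU) // xV.
  by rewrite -[c \notin V]andbT; have := supp c; rewrite inE andbT; case: (T c).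
have incF : shifted_increasing (cells (- 1) F).
  apply: (entries_increasing idU idV') => [c|c d u v].
    by rewrite -suppF; case: (F c).
  move=> /omap_key[s Fc <-] /omap_key[t Fd <-] cd ne; move: Fc Fd; rewrite !ffunE.
  case: ifP => [cx|ncx]; case: ifP => [dx|ndx].
  - by case: ne; exact: (corner_maximal idV sub cx (xV _ dx) cd).
  - by move=> [<-]; case: (T d) => //= w [<-] /=; rewrite /label_key; lia.
  - case Tc : (T c) => [w|//] _ _; have := supp c; rewrite Tc inE => /esym/andP[/negP[]].
    by apply: idV.2 cd _; [exact: xV|]; apply: idU.1; have := supp c; rewrite Tc inE => /esym/andP[].
  case Tc : (T c) => [w|//] [<-]; case Td : (T d) => [w'|//] [<-] /=.
  by apply: (entries_order inc _ _ cd ne); rewrite ?Tc ?Td.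
have srt : sorted ltn (labels T).
  by rewrite ltn_sorted_uniq_leq sort_uniq undup_uniq sort_sorted //; exact: leq_total.
case: (slide_labels srt incF) => [k _|c v Fc|e' [inc' lt' supp' same']].
- by rewrite /label_key; lia.
- right; rewrite mem_sort mem_undup mem_pmap; apply/mapP; exists c; first exact: mem_enum.
  by move: Fc; rewrite ffunE; case: ifP => // _; case: (T c) => //= w [->].
move: inc' lt' supp' same'; set F' := foldl _ _ _ => inc' lt' supp' same'.
have EF : delete_bullets F = T.
  apply/ffunP=> c; rewrite !ffunE; case: ifP => [/Tx->//|_].
  by case: (T c).
rewrite EF in same'.
have support' c : isSome (F' c) = (c \in U :\: (V :\: x)) by rewrite supp' suppF.
have order' c d s t : F' c = Some s -> F' d = Some t -> precedes c d -> c <> d ->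
    (key e' s < key e' t)%Z.
  by move=> Fc Fd; apply: (entries_order inc'); rewrite ?Fc ?Fd.
set X := [set c | F' c == Some bullet].
have idU' : ideal (U :\: X).
  split=> [c|c d]; first by rewrite inE => /andP[_ /idU.1].
  rewrite !inE => /andP[dX dU] cd cc; rewrite (idU.2 c d) // andbT.
  apply: contra dX => /eqP Fc.
  have [<-|/eqP ne] := eqVneq c d; first by rewrite Fc.
  have := support' d; case Fd : (F' d) => [s|].
    move=> _; case: s Fd => [[]|v] Fd; first by [].
    by have := order' _ _ _ _ Fc Fd cd ne; have := lt' _ _ Fd; rewrite /=; lia.
  rewrite in_setD dU andbT => /esym/negbFE dV.
  have := support' c; rewrite Fc in_setD => /esym/andP[/negP[]].
  exact: (idV'.2 _ _ dV cd cc).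
have supp1 c : isSome (Kjdt x T c) = (c \in (U :\: X) :\: (V :\: x)).
  rewrite /Kjdt -/F -/F' ffunE [RHS]in_setD [c \in U :\: X]in_setD [c \in X]inE.
  have := support' c; rewrite in_setD.
  by case Fc : (F' c) => [[[]|v]|] /= => [_|<-|<-]; rewrite ?eqxx ?andbF.
exists (U :\: X); split=> //; split=> //.
- apply/subsetP=> c cV; rewrite inE (subsetP VU) ?andbT; last by case/setDP: cV.
  by rewrite inE; apply/negP=> /eqP Fc; have := support' c; rewrite Fc in_setD cV.
- apply: (entries_increasing idU' idV') => [c|c d u v].
    by rewrite -supp1; case: (Kjdt x T c).
  rewrite /Kjdt -/F -/F' !ffunE.
  case Fc : (F' c) => [[[]|k]|] //= [<-]; case Fd : (F' d) => [[[]|m]|] //= [<-].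
  exact: (order' _ _ _ _ Fc Fd).
Qed.

Lemma rectification xs U V T : skew_tableau U V T -> Krect_order V xs ->
  exists U', skew_tableau U' set0 (Krect xs T) /\
             same_statistics (tab T) (tab (Krect xs T)).
Proof.
elim: xs U V T => [|x xs IH] U V T sk /= => [/eqP V0|/and3P[_ sub ord]].
  by subst V; exists U; split.
have [U1 [sk1 same1]] := slide sk sub.
have [U2 [sk2 same2]] := IH _ _ _ sk1 ord.
exists U2; split=> //; exact: same_trans same1 same2.
Qed.

Lemma straight_tableau U T : skew_tableau U set0 T -> straight (tab T).
Proof.
case=> idU _ _ supp inc; split=> //.
  by move=> i j u [c [<- _ _]]; lia.
move=> i j u i' j' [c [Ei Ej Tc]] ri jj ij.
have cU : c \in U.
  by have := supp c; case: (T c) Tc => // v _; rewrite in_setD => /esym/andP[].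
have i'n : Z.to_nat i' < n by have := ltn_ord c.1; lia.
have j'n : Z.to_nat j' < n by have := ltn_ord c.2; lia.
have [d [E1 E2]] := box_at i'n j'n.
have : isSome (T d).
  rewrite supp in_setD in_set0 /=; apply: (idU.2 d c cU); rewrite ?/precedes; lia.
by case Td : (T d) => [v|//] _; exists (label_key v), d; split; [lia|lia|rewrite Td].
Qed.

Lemma tableau_ext T T' :
  (forall i j u, tab T i j u <-> tab T' i j u) -> T = T'.
Proof.
have incl T1 T2 : (forall i j u, tab T1 i j u -> tab T2 i j u) ->
    forall c v, T1 c = Some v -> T2 c = Some v.
  move=> sub c v Tc.
  have /sub/entries_box : tab T1 (Z.of_nat c.1) (Z.of_nat c.2) (label_key v).
    by exists c; rewrite Tc.
  by case: (T2 c) => //= w [E]; congr Some; move: E; rewrite /label_key; lia.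
move=> eqT; apply/ffunP=> c.
case Tc : (T c) => [v|]; first by rewrite (incl T T' _ _ _ Tc) // => i j u /eqT.
case Tc' : (T' c) => [v|//]; rewrite -Tc.
by rewrite (incl T' T _ _ _ Tc') // => i j u /eqT.
Qed.

Lemma superstandard_row mu r j u : tab (superstandard n mu) (Z.of_nat r) j u ->
  (2 * Z.of_nat (sumn (take r mu)) < u <= 2 * Z.of_nat (sumn (take r.+1 mu)))%Z.
Proof.
case=> -[i j'] [Er _]; rewrite ffunE inE /fst /snd.
have {Er}-> : r = i by move: Er; rewrite /fst; lia.
case: ifP => // /andP[lt bd] [<-].
rewrite (take_nth 0 lt) sumn_rcons /label_key; lia.
Qed.

Lemma ideal_diagram la : is_shape n la -> ideal (diagram n la).
Proof.
case/and3P=> srt _ _; split=> [c|c d]; rewrite !inE; first by case/and3P.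
have gtn_trans : transitive gtn by move=> x y z /= xy yz; exact: ltn_trans yz xy.
have strict a b : a <= b < size la -> nth 0 la b + (b - a) <= nth 0 la a.
  elim: b => [|b IH] /andP[ab bl]; first by (have -> : a = 0 by lia); lia.
  have [E|lt] : a = b.+1 \/ a <= b by lia.
    by rewrite E subnn addn0.
  have /= := sorted_ltn_nth gtn_trans 0 srt b b.+1 (ltnW bl) bl (ltnSn b).
  by have := IH ltac:(lia); lia.
case/and3P=> dl dd dn; rewrite /precedes => cd cc.
by have := strict c.1 d.1 ltac:(lia); lia.
Qed.

Lemma skew_tableau_INC la nu T : is_shape n la -> is_shape n nu ->
  diagram n la \subset diagram n nu -> INC nu la T ->
  skew_tableau (diagram n nu) (diagram n la) T.
Proof.
move=> /ideal_diagram idla /ideal_diagram idnu sub [supp [rows cols]].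
split=> //; apply: (entries_increasing idnu idla) => [c|c d u v].
  by rewrite -[RHS]supp; case: (T c).
case Tc : (T c) => [a|//] [<-]; case Td : (T d) => [b|//] [<-] cd ne.
move: cd; rewrite /precedes => cd.
have inU e w : T e = Some w -> e \in diagram n nu /\ e \notin diagram n la.
  by move=> Te; have := supp e; rewrite Te in_setD => /esym/andP[].
have [[cU cV] [dU dV]] := (inU _ _ Tc, inU _ _ Td).
have cc := idnu.1 _ cU; have dd := idnu.1 _ dU.
have [e [E1 E2]] := box_at (ltn_ord c.1) (ltn_ord d.2).
have row_lt c1 d1 m p : c1.1 = d1.1 :> nat -> c1.2 < d1.2 ->
    T c1 = Some m -> T d1 = Some p -> m < p.
  by case: c1 d1 => [i j] [i' j'] /= /ord_inj->; exact: rows.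
have col_lt c1 d1 m p : c1.2 = d1.2 :> nat -> c1.1 < d1.1 ->
    T c1 = Some m -> T d1 = Some p -> m < p.
  by case: c1 d1 => [i j] [i' j'] /= /ord_inj->; exact: cols.
have : isSome (T e).
  rewrite supp in_setD; apply/andP; split.
    by apply: contra cV => eV; apply: (idla.2 _ _ eV); rewrite ?/precedes; lia.
  by apply: (idnu.2 _ _ dU); rewrite ?/precedes; lia.
case Te : (T e) => [m|//] _.
have am : c = e \/ a < m.
  have [lt|ge] := ltnP c.2 d.2; [right|left; apply: box_eq; lia].
  by apply: (row_lt c e) => //; lia.
have mb : d = e \/ m < b.
  have [lt|ge] := ltnP c.1 d.1; [right|left; apply: box_eq; lia].
  by apply: (col_lt e d) => //; lia.
suff : a < b by rewrite /label_key; lia.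
case: am mb => [Ec|am] [Ed|mb].
- by case: ne; rewrite Ec.
- by subst e; move: Te; rewrite Tc => -[->].
- by subst e; move: Te; rewrite Td => -[->].
- exact: ltn_trans mb.
Qed.

End Fillings.

Theorem theorem1p1 (n : nat) (n_ge1 : 1 <= n) (la nu mu : seq nat)
    (la_shape : is_shape n la) (nu_shape : is_shape n nu)
    (mu_shape : is_shape n mu) (la_sub_nu : diagram n la \subset diagram n nu)
    (T : tableau n) (T_inc : INC nu la T) :
  (exists xs : seq {set box n},
     rectifies_using la xs T (superstandard n mu)) ->
  forall ys : seq {set box n},
    Krect_order (diagram n la) ys ->
    rectifies_using la ys T (superstandard n mu).
Proof.
have sk := skew_tableau_INC la_shape nu_shape la_sub_nu T_inc.
move=> [xs [xs_order xs_rect]] ys ys_order; split=> //.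
have [U [skU sameU]] := rectification sk xs_order.
have [W [skW sameW]] := rectification sk ys_order.
rewrite xs_rect in skU sameU.
apply/esym/tableau_ext.
apply: (rigid (straight_tableau skU) (straight_tableau skW)
  (same_trans (same_sym sameU) sameW)
  (M := fun r => (2 * Z.of_nat (sumn (take r mu)))%Z)).
  move=> r; have [lt|ge] := ltnP r (size mu).
    by rewrite (take_nth 0 lt) sumn_rcons; lia.
  by rewrite !take_oversize ?leqW //; lia.
exact: superstandard_row.
Qed.
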